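(* Let $\mathcal{B}\subseteq\mathcal{M}$ be a unital inclusion of von Neumann algebras. Then $$\operatorname{span}\bigl(\mathcal{N}_{\mathcal{M}}(\mathcal{B})\bigr)=\operatorname{span}\bigl(\mathcal{GN}_{\mathcal{M}}(\mathcal{B})\bigr).$$ Consequently, $\mathcal{B}$ is regular in $\mathcal{M}$ if and only if it is groupoid regular in $\mathcal{M}$.
   Context: A unital inclusion $\mathcal{B}\subseteq\mathcal{M}$ of von Neumann algebras means that $\mathcal{B}$ is a von Neumann subalgebra of $\mathcal{M}$ with $1_{\mathcal{B}}=1_{\mathcal{M}}$. The normaliser of $\mathcal{B}$ in $\mathcal{M}$ is $\mathcal{N}_{\mathcal{M}}(\mathcal{B})=\{n\in\mathcal{M}: n\mathcal{B}n^*\cup n^*\mathcal{B}n\subseteq\mathcal{B}\}$. The groupoid normaliser is $\mathcal{GN}_{\mathcal{M}}(\mathcal{B})=\{v\in\mathcal{N}_{\mathcal{M}}(\mathcal{B}): vv^*v=v\}$, the set of partial isometries in $\mathcal{N}_{\mathcal{M}}(\mathcal{B})$. $\operatorname{span}$ denotes the complex linear span (no closure), and $W^*(S)$ denotes the von Neumann subalgebra of $\mathcal{M}$ generated by $S$. $\mathcal{B}$ is regular in $\mathcal{M}$ if $W^*(\mathcal{N}_{\mathcal{M}}(\mathcal{B}))=\mathcal{M}$, and groupoid regular in $\mathcal{M}$ if $W^*(\mathcal{GN}_{\mathcal{M}}(\mathcal{B}))=\mathcal{M}$. *)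

(* Defs.v *)
From HB Require Import structures.
From mathcomp Require Import all_boot all_order all_algebra.
From mathcomp Require Import all_classical all_reals all_analysis.
From mathcomp Require Import complex.

Set Implicit Arguments.
Unset Strict Implicit.
Unset Printing Implicit Defensive.

Import Order.TTheory GRing.Theory Num.Theory numFieldNormedType.Exports.

Local Open Scope classical_set_scope.
Local Open Scope complex_scope.
Local Open Scope ring_scope.

(* The inner product is linear in its first argument
   and conjugate-linear in the second one. *)
HB.mixin Record isHilbert (R : realType) H of CompleteNormedModule R[i] H := {
  hdot : {dot H for Num.conj};
  hdot_norm : forall x : H, hdot x x = `|x| ^+ 2 }.

#[short(type="hilbertType")]
HB.structure Definition Hilbert (R : realType) :=
  { H of CompleteNormedModule R[i] H & isHilbert R H }.

Definition bounded_operator (R : realType) (H : hilbertType R) : {pred H -> H} :=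
  [pred T | `[< linear T /\ exists M : R[i], forall x : H, `|T x| <= M * `|x| >]].

Record boundedOp (R : realType) (H : hilbertType R) := BoundedOp {
  op_fun :> H -> H;
  op_bounded : op_fun \in @bounded_operator R H }.

Notation "''B' ( H )" := (boundedOp H) (format "''B' ( H )") : type_scope.

(* 'B(H) is a module for the pointwise operations, and a ring whose product is
   composition; this ring is trivial when H is, hence a pzRingType. *)
Section boundedOp_algebra.
Variables (R : realType) (H : hilbertType R).

HB.instance Definition _ := [isSub for @op_fun R H].
HB.instance Definition _ := [Choice of 'B(H) by <:].

Lemma bounded_operatorP (T : H -> H) :
  reflect (linear T /\ exists M : R[i], forall x : H, `|T x| <= M * `|x|)
          (T \in @bounded_operator R H).
Proof. exact: asboolP. Qed.

Lemma ge0_bounded_operatorP (T : H -> H) : T \in @bounded_operator R H ->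
  linear T /\
  exists2 M : R[i], 0 <= M & forall x : H, `|T x| <= M * `|x|.
Proof.
move=> /bounded_operatorP[linT [M TM]]; split=> //; exists `|M| => // x.
have Mx0 : 0 <= M * `|x| by rewrite (le_trans _ (TM x)).
by rewrite -[X in _ * X]normr_id -normrM ger0_norm.
Qed.

Lemma bounded_operator_submod_closed : submod_closed (@bounded_operator R H).
Proof.
split=> [|a S T].
  apply/bounded_operatorP; split=> [c x y|].
    by rewrite -[LHS]/(0 : H) -[c *: _ + _]/(c *: (0 : H) + 0) scaler0 addr0.
  by exists 0 => x; rewrite -[(0 : H -> H) x]/(0 : H) normr0 mul0r.
move=> /ge0_bounded_operatorP[linS [M M0 SM]].
move=> /ge0_bounded_operatorP[linT [N N0 TN]].
have E x : (a *: S + T) x = a *: S x + T x by [].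
apply/bounded_operatorP; split=> [c x y|].
  rewrite !E linS linT !scalerDr !scalerA [a * c]mulrC -!addrA.
  by congr (_ + _); rewrite addrCA.
exists (`|a| * M + N) => x; rewrite E (le_trans (ler_normD _ _))// mulrDl lerD//.
by rewrite normrZ -mulrA ler_wpM2l.
Qed.

HB.instance Definition _ := GRing.isSubmodClosed.Build _ _
  (@bounded_operator R H) bounded_operator_submod_closed.
HB.instance Definition _ := [SubChoice_isSubLmodule of 'B(H) by <:].

Fact op_one_subproof : id \in @bounded_operator R H.
Proof.
by apply/bounded_operatorP; split=> //; exists 1 => x; rewrite mul1r.
Qed.

Fact op_mul_subproof (S T : 'B(H)) : S \o T \in @bounded_operator R H.
Proof.
have [linS [M M0 SM]] := ge0_bounded_operatorP (op_bounded S).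
have [linT [N N0 TN]] := ge0_bounded_operatorP (op_bounded T).
apply/bounded_operatorP; split=> [c x y|]; first by rewrite /= linT linS.
exists (M * N) => x /=; apply: (le_trans (SM _)).
by rewrite -mulrA ler_wpM2l.
Qed.

Definition op_one := BoundedOp op_one_subproof.
Definition op_mul (S T : 'B(H)) := BoundedOp (op_mul_subproof S T).

Lemma opP (S T : 'B(H)) : S =1 T -> S = T.
Proof. by move=> ST; apply/val_inj/funext. Qed.

Lemma opD (S T : 'B(H)) x : (S + T) x = S x + T x.
Proof. by []. Qed.

Lemma op_mulA : associative op_mul.
Proof. by move=> S T U; apply: opP. Qed.

Lemma op_mul1 : left_id op_one op_mul.
Proof. by move=> S; apply: opP. Qed.

Lemma op_mulr1 : right_id op_one op_mul.
Proof. by move=> S; apply: opP. Qed.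

Lemma op_mulDl : left_distributive op_mul +%R.
Proof. by move=> S T U; apply: opP. Qed.

Lemma op_mulDr : right_distributive op_mul +%R.
Proof.
move=> S T U; apply: opP => x.
have [linS _] := ge0_bounded_operatorP (op_bounded S).
rewrite -[LHS]/(S (T x + U x)) -[RHS]/(S (T x) + S (U x)).
by rewrite -[T x]scale1r linS !scale1r.
Qed.

HB.instance Definition _ := GRing.Zmodule_isPzRing.Build 'B(H)
  op_mulA op_mul1 op_mulr1 op_mulDl op_mulDr.

Lemma op1E x : (1 : 'B(H)) x = x. Proof. by []. Qed.

Lemma opME (S T : 'B(H)) x : (S * T) x = S (T x). Proof. by []. Qed.

Lemma opZE a (S : 'B(H)) x : (a *: S) x = a *: S x. Proof. by []. Qed.

End boundedOp_algebra.

Section von_Neumann.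
Variables (R : realType) (H : hilbertType R).
Implicit Types (S T : 'B(H)) (A B M : set 'B(H)).

(* The operator selected here exists by the Riesz representation theorem and
   is unique because the inner product is definite. *)
Definition adjoint T : 'B(H) :=
  xget 0 [set S : 'B(H) | forall x y : H, hdot (T x) y = hdot x (S y)].

(* The weak operator topology, as the topology induced by the matrix
   coefficients (x, y) |-> <T x, y>. *)
Definition wot := initial_topology
  (fun T : 'B(H) => (fun xy => hdot (T xy.1) xy.2) : {ptws H * H -> R[i]^o}).

(* A von Neumann algebra on H is a weak-operator closed *-subalgebra of 'B(H)
   that contains the identity operator. *)
Definition is_vN_algebra A :=
  [/\ A 1,
      forall (a : R[i]) S T, A S -> A T -> A (a *: S + T),
      forall S T, A S -> A T -> A (S * T),
      forall T, A T -> A (adjoint T) &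
      closed (A : set wot)].

Definition is_vN_subalgebra B M := is_vN_algebra B /\ B `<=` M.

(* Both algebras contain the identity operator, so they share their unit. *)
Definition unital_inclusion B M := is_vN_algebra M /\ is_vN_subalgebra B M.

Definition normaliser B M : set 'B(H) :=
  [set n | M n /\ forall b, B b ->
             B (n * b * adjoint n) /\ B (adjoint n * b * n)].

Definition groupoid_normaliser B M : set 'B(H) :=
  [set v | normaliser B M v /\ v * adjoint v * v = v].

Definition cspan (X : set 'B(H)) : set 'B(H) :=
  [set T | exists (k : nat) (c : 'I_k -> R[i]) (s : 'I_k -> 'B(H)),
             (forall i, X (s i)) /\ T = \sum_(i < k) c i *: s i].

Definition vN_generated M (X : set 'B(H)) : set 'B(H) :=
  \bigcap_(A in [set A | is_vN_subalgebra A M /\ X `<=` A]) A.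

Definition regular B M := vN_generated M (normaliser B M) = M.

Definition groupoid_regular B M :=
  vN_generated M (groupoid_normaliser B M) = M.

End von_Neumann.

(* Main.v *)
Require Import Defs.
From mathcomp Require Import all_boot all_order all_algebra.
From mathcomp Require Import all_classical all_reals all_analysis.
From mathcomp Require Import complex ring.

Set Implicit Arguments.
Unset Strict Implicit.
Unset Printing Implicit Defensive.

Import Order.TTheory GRing.Theory Num.Theory numFieldNormedType.Exports.

Local Open Scope classical_set_scope.
Local Open Scope complex_scope.
Local Open Scope ring_scope.

(** Write [a^+] for the adjoint of an operator [a].  Since both spans are the
    smallest subspaces containing the two sets, and a von Neumann algebra
    contains a set exactly when it contains its span, everything reduces to
    writing a normaliser [n] with [|n x| <= |x|] as a combination of elements
    of the groupoid normaliser.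

    The classical argument takes the polar decomposition [n = V |n|]: the
    operator [|n|] lies in [B], hence is a combination of unitaries [w] of [B],
    and each [V w] is a partial isometry normalising [B].  Here the partial
    isometry [V] is obtained as the strong limit of the Newton-Schulz iterates
    [X_0 = n], [X_(k+1) = X_k (3 - X_k^+ X_k) / 2], so that no functional
    calculus is needed.  Three features of this iteration are used.
    - [X_(k+1)] is [X_k] times an element of [B], because
      [X_k^+ X_k = X_k^+ 1 X_k] is in [B]; so all the iterates normalise [B].
    - The functions [k |-> |X_k x|^2] are nondecreasing and bounded by [|x|^2],
      and [|X_l x - X_k x|^2 <= |X_l x|^2 - |X_k x|^2] for [k <= l]; so the
      iterates converge strongly ([ns_iter_dist], [ns_iter_limit]).
    - The adjoint of an iterate is the corresponding iterate of [n^+], so the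
      adjoints converge strongly as well.  Products of contractions being
      jointly continuous for the strong topology, [V] normalises [B], and the
      recurrence becomes [V = V (3 - V^+ V) / 2] in the limit, that is
      [V = V V^+ V].
    Finally [c = V^+ n] is a selfadjoint contraction of [B] with [n = V c]
    ([polar_decomposition]), and [c = (w + w^+) / 2] where
    [w = c + i sqrt(1 - c^2)] is a unitary of [B] ([half_sum_unitaries]).

    The positivity behind the second feature is that of a product of commuting
    positive operators, one factor being [1 - X_l^+ X_l].  It follows from the
    existence of a square root of [1 - T] for a selfadjoint contraction [T]
    ([sqrt_contraction]), which also provides [sqrt(1 - c^2)].

    Adjoints exist by the Riesz representation theorem, and the only
    topological fact needed about von Neumann algebras is that they contain the
    limits of their strongly convergent sequences. *)

(** * Sequences of complex numbers and of vectors *)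

Section complex_sequences.
Variable R : realType.
Implicit Types (z : R[i]) (u v : nat -> R[i]^o).

Lemma ge0_complexE z : 0 <= z -> z = (complex.Re z)%:C.
Proof. by move=> z0; rewrite RRe_real // ger0_real. Qed.

(** Suprema exist in [R]; this carries them to the real elements of the
    partially ordered field [R[i]], in which the squared norms live. *)
Lemma real_sup_adherent (P : set R[i]) z0 (m : R[i]) :
  P z0 -> (forall z, P z -> z \is Num.real /\ z <= m) ->
  exists s : R[i], (forall z, P z -> z <= s) /\
    forall e, 0 < e -> exists2 z, P z & s - e < z.
Proof.
move=> Pz0 Pm; pose E := [set x : R | P x%:C].
have EP z : P z -> E (complex.Re z) /\ z = (complex.Re z)%:C.
  by move=> Pz; have [zr _] := Pm _ Pz; rewrite /E/= RRe_real.
have supE : has_sup E.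
  split; first by exists (complex.Re z0); have [] := EP _ Pz0.
  exists (complex.Re m) => x /Pm[_]; by rewrite lecE => /andP[].
exists (sup E)%:C; split=> [z /EP[Ez ->]|e e0].
  by rewrite lecR; apply: sup_upper_bound.
have e0' : 0 < complex.Re e by move: e0; rewrite ltcE => /andP[].
have [x Ex xs] := sup_adherent e0' supE.
exists x%:C => //; rewrite (ge0_complexE (ltW e0)) -rmorphB ltcR//.
Qed.

Lemma nondecreasing_bounded_cauchy u (m : R[i]) :
  (forall k, 0 <= u k) -> (forall k l, (k <= l)%N -> u k <= u l) ->
  (forall k, u k <= m) -> forall e, 0 < e ->
  exists N, forall k l, (N <= k)%N -> (k <= l)%N -> u l - u k < e.
Proof.
move=> u0 u_nd um e e0.
have [||s [us sP]] := @real_sup_adherent (range u) (u 0%N) m.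
- by exists 0%N.
- by move=> _ [k _ <-]; split=> //; rewrite ger0_real.
have [_ [N _ <-] uN] := sP e e0.
exists N => k l Nk kl; apply: le_lt_trans (_ : s - u k < e).
  by rewrite lerD2r us//; exists l.
by rewrite ltrBlDr -ltrBlDl (lt_le_trans uN)// u_nd.
Qed.

Lemma natSinv_lt (e : R[i]) : 0 < e ->
  exists N, forall k, (N <= k)%N -> k.+1%:R^-1 < e.
Proof.
move=> e0; have e0' : 0 < complex.Re e by move: e0; rewrite ltcE => /andP[].
have [N _ NP] := near_infty_natSinv_lt (PosNum e0').
exists N => k /NP /= ke; rewrite (ge0_complexE (ltW e0)).
by rewrite -(rmorph_nat (real_complex R)) -fmorphV ltcR.
Qed.

Lemma cvg_natSinv : k.+1%:R^-1 @[k --> \oo] --> (0 : R[i]^o).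
Proof.
apply/cvgrPdist_lt => e /natSinv_lt[N NP]; exists N => // k /NP.
by rewrite sub0r normrN ger0_norm// invr_ge0.
Qed.

(** The order of [R[i]] is not total, so limits of inequalities are reduced to
    the continuity of the norm: [u = |u|] passes to the limit. *)
Lemma cvg_ge0 u (z : R[i]^o) :
  (forall k, 0 <= u k) -> u k @[k --> \oo] --> z -> 0 <= z.
Proof.
move=> u0 uz; have uz' : `|u k| @[k --> \oo] --> `|z| by exact: cvg_norm.
have uE : (fun k => `|u k|) = u by apply/funext => k; rewrite ger0_norm.
rewrite uE in uz'.
by rewrite (norm_cvg_unique uz uz') normr_ge0.
Qed.

Lemma cvg_le u v (a b : R[i]^o) : (forall k, u k <= v k) ->
  u k @[k --> \oo] --> a -> v k @[k --> \oo] --> b -> a <= b.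
Proof.
move=> uv ua vb; rewrite -subr_ge0.
by apply: cvg_ge0 (cvgB vb ua) => k /=; rewrite subr_ge0.
Qed.

Lemma cauchy_seq_cvg (V : completeNormedModType R[i]) (x : nat -> V) :
  (forall e : R[i], 0 < e -> exists N, forall k l,
     (N <= k)%N -> (k <= l)%N -> `|x l - x k| < e) ->
  exists a : V, x k @[k --> \oo] --> a.
Proof.
move=> xC; suff /cvg_ex : cvg (x k @[k --> \oo]) by [].
apply: cauchy_cvg; apply: cauchy_exP => e /xC[N NP].
exists (x N), N => // k Nk; rewrite -ball_normE /ball_/= distrC.
exact: NP.
Qed.

End complex_sequences.

(** * The Riesz representation theorem *)

Section Riesz.
Variables (R : realType) (H : hilbertType R).
Implicit Types (x y z : H) (a : R[i]).

Lemma dotC x y : hdot x y = (hdot y x)^*%R.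
Proof. by rewrite hermC expr0 mul1r. Qed.

Lemma dotZl a x y : hdot (a *: x) y = a * hdot x y.
Proof. exact: linearZl_LR. Qed.

Lemma dotZr a x y : hdot x (a *: y) = a^*%R * hdot x y.
Proof. exact: linearZr_LR. Qed.

Lemma dotDl x y z : hdot (x + y) z = hdot x z + hdot y z.
Proof. exact: linearDl. Qed.

Lemma dotDr x y z : hdot z (x + y) = hdot z x + hdot z y.
Proof. exact: linearDr. Qed.

Lemma dotBl x y z : hdot (x - y) z = hdot x z - hdot y z.
Proof. exact: linearBl. Qed.

Lemma dotBr x y z : hdot z (x - y) = hdot z x - hdot z y.
Proof. exact: linearBr. Qed.

Lemma dot_eq0 x : hdot x x = 0 -> x = 0.
Proof. by rewrite hdot_norm => /eqP; rewrite sqrf_eq0 normr_eq0 => /eqP. Qed.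

Lemma dot_inj x y : (forall z, hdot z x = hdot z y) -> x = y.
Proof.
by move=> xy; apply/subr0_eq/dot_eq0; rewrite dotBr xy subrr.
Qed.

(** The vector [|y|^2 x - <x, y> y] is [|y|^2] times the part of [x] orthogonal
    to [y]; its squared norm being nonnegative is the inequality. *)
Lemma cauchy_schwarz x y : `|hdot x y| <= `|x| * `|y|.
Proof.
have [->|y0] := eqVneq y 0; first by rewrite linear0r !normr0 mulr0.
have y2 : 0 < `|y| ^+ 2 by rewrite exprn_gt0// normr_gt0.
rewrite -(@ler_pXn2r _ 2)// ?nnegrE ?mulr_ge0// -(ler_pM2l y2).
have : let z := `|y| ^+ 2 *: x - hdot x y *: y in 0 <= hdot z z.
  by rewrite /= hdot_norm exprn_ge0.
rewrite /= dotBl !dotBr !dotZl !dotZr !hdot_norm (dotC y x) normCK.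
rewrite (conj_Creal (x := `|y| ^+ 2)) ?ger0_real ?exprn_ge0//.
rewrite -subr_ge0; congr (is_true (0 <= _)); ring.
Qed.

Lemma cvg_dotl (u : nat -> H) x y : u k @[k --> \oo] --> x ->
  (hdot (u k) y : R[i]^o) @[k --> \oo] --> (hdot x y : R[i]^o).
Proof.
move=> ux; apply/cvgrPdist_lt => e e0.
have y1 : 0 < `|y| + 1 by rewrite ltr_wpDl.
have /cvgrPdist_lt/(_ _ (divr_gt0 e0 y1)) := ux.
apply: filterS => k uk; rewrite -dotBl (le_lt_trans (cauchy_schwarz _ _))//.
rewrite (@le_lt_trans _ _ (`|x - u k| * (`|y| + 1)))//.
  by rewrite ler_wpM2l// lerDl.
by rewrite -ltr_pdivlMr.
Qed.

Lemma cvg_dotr (u : nat -> H) x y : u k @[k --> \oo] --> x ->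
  (hdot y (u k) : R[i]^o) @[k --> \oo] --> (hdot y x : R[i]^o).
Proof.
move=> ux; apply/cvgrPdist_lt => e e0.
have /cvgrPdist_lt/(_ _ e0) := cvg_dotl (y := y) ux.
apply: filterS => k; rewrite -dotBl -dotBr.
by rewrite dotC norm_conjC.
Qed.

(** The representing vector maximises the real functional
    [J x = 2 Re (f x) - |x|^2]: the parallelogram law makes a maximising
    sequence a Cauchy sequence, and the first variation of [J] at its limit
    [x] is [2 Re (f w - <w, x>)], which therefore vanishes for all [w]. *)
Lemma Riesz_representation (f : H -> R[i]) (C : R[i]) :
  (forall a x y, f (a *: x + y) = a * f x + f y) ->
  (forall x, `|f x| <= C * `|x|) ->
  exists z, forall x, f x = hdot x z.
Proof.
move=> f_lin f_bnd.
have f0 : f 0 = 0.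
  have := f_lin 1 0 0; rewrite scale1r addr0 mul1r => f00.
  by apply: (addrI (f 0)); rewrite addr0 -f00.
have fZ a x : f (a *: x) = a * f x by have := f_lin a x 0; rewrite f0 !addr0.
have fD x y : f (x + y) = f x + f y.
  by have := f_lin 1 x y; rewrite scale1r mul1r.
pose J x := f x + (f x)^*%R - hdot x x.
have J_real x : J x \is Num.real.
  apply/CrealP; rewrite /J rmorphB rmorphD /= conjCK [_ + f x]addrC.
  by rewrite (conj_Creal (x := hdot x x))// hdot_norm ger0_real ?exprn_ge0.
have J_bnd x : J x <= `|C| ^+ 2.
  have fx : f x + (f x)^*%R <= 2%:R * (`|C| * `|x|).
    rewrite (@le_trans _ _ `|f x + (f x)^*%R|)//.
      apply: real_ler_norm.
      by apply/CrealP; rewrite rmorphD /= conjCK addrC.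
    rewrite (le_trans (ler_normD _ _))// norm_conjC mulr_natl mulr2n.
    have Cx : `|f x| <= `|C| * `|x|.
      rewrite (le_trans (f_bnd x))// -[X in _ <= _ * X]normr_id -normrM.
      by apply/real_ler_norm/ger0_real/(le_trans _ (f_bnd x)).
    by rewrite lerD.
  rewrite /J hdot_norm lerBlDr (le_trans fx)// -subr_ge0.
  have -> : `|C| ^+ 2 + `|x| ^+ 2 - 2%:R * (`|C| * `|x|) = (`|C| - `|x|) ^+ 2.
    by ring.
  by rewrite real_exprn_even_ge0// rpredB ?normr_real.
have [||s [Js sJ]] := @real_sup_adherent R (range J) (J 0) (`|C| ^+ 2).
- by exists 0.
- by move=> _ [x _ <-].
have /choice[u uJ] k : exists x, s - k.+1%:R^-1 < J x.
  have k0 : 0 < k.+1%:R^-1 :> R[i] by rewrite invr_gt0.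
  by have [_ [x _ <-]] := sJ _ k0; exists x.
have Jle x : J x <= s by apply: Js; exists x.
have [e e0|z uz] := @cauchy_seq_cvg R H u.
  have e2 : 0 < e ^+ 2 / 4%:R by rewrite divr_gt0// exprn_gt0.
  have [N NP] := natSinv_lt e2; exists N => k l Nk kl.
  rewrite -(@ltr_pXn2r _ 2)// ?nnegrE// ?(ltW e0)// -hdot_norm.
  (* parallelogram law, with [J] in place of the squared norm *)
  have -> : hdot (u l - u k) (u l - u k) =
      4%:R * J (2%:R^-1 *: (u l + u k)) - 2%:R * J (u l) - 2%:R * J (u k).
    rewrite /J fZ fD dotZl dotZr dotBl !dotBr dotDl !dotDr.
    rewrite rmorphM rmorphD fmorphV /= !conjC_nat.
    by field.
  have Jk m : (N <= m)%N -> s - J (u m) < e ^+ 2 / 4%:R.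
    by move=> /NP; apply: lt_trans; rewrite ltrBlDr -ltrBlDl.
  have -> : e ^+ 2 =
      4%:R * s - 2%:R * (s - e ^+ 2 / 4%:R) - 2%:R * (s - e ^+ 2 / 4%:R).
    by field.
  have kJ m : (N <= m)%N -> 2%:R * (s - e ^+ 2 / 4%:R) < 2%:R * J (u m).
    by move=> /Jk mJ; rewrite ltr_pM2l// ltrBlDr -ltrBlDl.
  apply: ltrB (kJ _ Nk); apply: ler_ltB (kJ _ (leq_trans Nk kl)).
  by rewrite ler_wpM2l.
exists z => y; apply/subr0_eq/eqP.
pose g w := f w - hdot w z; rewrite -[_ - _]/(g y).
have gle w : g w + (g w)^*%R <= `|w| ^+ 2.
  have le_k k : f w + (f w)^*%R - `|w| ^+ 2 - k.+1%:R^-1 <=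
      hdot w (u k) + (hdot w (u k))^*%R.
    rewrite -(dotC (u k) w).
    have := le_lt_trans (Jle (u k + w)) (_ : s < J (u k) + k.+1%:R^-1).
    rewrite -ltrBlDr => /(_ (uJ k)) /ltW; rewrite -subr_ge0 => h.
    rewrite -subr_ge0; move: h; rewrite /J fD dotDl !dotDr rmorphD /= -hdot_norm.
    by congr (is_true (0 <= _)); ring.
  have : f w + (f w)^*%R - `|w| ^+ 2 - 0 <= hdot w z + (hdot w z)^*%R.
    rewrite -(dotC z w); apply: (cvg_le le_k).
      by apply: cvgB; [exact: cvg_cst|exact: cvg_natSinv].
    apply: cvgD; first exact: cvg_dotr.
    by under eq_fun do rewrite -dotC; exact: cvg_dotl.
  rewrite -subr_ge0 => h; rewrite -subr_ge0; move: h; rewrite /g rmorphB /=.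
  by congr (is_true (0 <= _)); ring.
(* First variation along [y]: the step [conj (g y) / D] makes the linear term
   [2 |g y|^2 / D] exceed the quadratic one [|g y|^2 |y|^2 / D^2]. *)
apply/negP => /negP gy0; pose D := 1 + `|y| ^+ 2.
have D0 : 0 < D by rewrite ltr_wpDr// exprn_ge0.
have DV : (D^-1)^*%R = D^-1.
  by rewrite conj_Creal// rpredV ger0_real// ltW.
have := gle ((D^-1 * (g y)^*%R) *: y).
rewrite -hdot_norm dotZl dotZr hdot_norm /g fZ dotZl -mulrBr -/(g y).
rewrite !rmorphM /= conjCK DV.
rewrite -(ler_pM2l (exprn_gt0 2 D0)).
have G0 : 0 < g y * (g y)^*%R by rewrite -normCK exprn_gt0// normr_gt0.
have -> : D ^+ 2 * (D^-1 * (g y)^*%R * g y + D^-1 * g y * (g y)^*%R) =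
    (g y * (g y)^*%R) * (2%:R * D).
  by field; rewrite gt_eqF.
have -> : D ^+ 2 * (D^-1 * (g y)^*%R * (D^-1 * g y * `|y| ^+ 2)) =
    (g y * (g y)^*%R) * `|y| ^+ 2.
  by field; rewrite gt_eqF.
rewrite ler_pM2l// => /le_gtF.
rewrite -subr_gt0 (_ : _ - _ = D + 1); last by rewrite /D; ring.
by rewrite addr_gt0.
Qed.

End Riesz.

(** * Adjoints and strong convergence *)

Section operators.
Variables (R : realType) (H : hilbertType R).
Implicit Types (x y z : H) (a : R[i]) (S T : 'B(H)) (u v : nat -> 'B(H)).

Lemma op_linear T a x y : T (a *: x + y) = a *: T x + T y.
Proof.
by have [linT _] := ge0_bounded_operatorP (op_bounded T); exact: linT.
Qed.

Lemma op_additive T x y : T (x + y) = T x + T y.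
Proof. by rewrite -{1}[x]scale1r op_linear scale1r. Qed.

Lemma op_0 T : T 0 = 0.
Proof.
by apply: (addrI (T 0)); rewrite addr0 -op_additive addr0.
Qed.

Lemma op_scale T a x : T (a *: x) = a *: T x.
Proof. by rewrite -[a *: x]addr0 op_linear op_0 addr0. Qed.

Lemma op_sub T x y : T (x - y) = T x - T y.
Proof. by rewrite -scaleN1r op_additive op_scale scaleN1r. Qed.

Lemma opBE S T x : (S - T) x = S x - T x. Proof. by []. Qed.

Lemma adjoint_exists T : exists S, forall x y, hdot (T x) y = hdot x (S y).
Proof.
have [_ [C C0 TC]] := ge0_bounded_operatorP (op_bounded T).
have /choice[S TS] y : exists z, forall x, hdot (T x) y = hdot x z.
  apply: (@Riesz_representation _ _ _ (C * `|y|)) => [a x x'|x].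
    by rewrite op_linear dotDl dotZl.
  rewrite (le_trans (cauchy_schwarz _ _))// mulrAC ler_wpM2r//.
have S_lin : linear S.
  move=> a x y; apply: dot_inj => z.
  by rewrite -TS !dotDr !dotZr !TS.
have S_bnd x : `|S x| <= C * `|x|.
  have [->|Sx0] := eqVneq (S x) 0; first by rewrite normr0 mulr_ge0.
  rewrite -(@ler_pM2l _ `|S x|) ?normr_gt0// -expr2 -hdot_norm -TS.
  have Sx : 0 <= hdot (T (S x)) x by rewrite TS hdot_norm exprn_ge0.
  rewrite -(ger0_norm Sx) (le_trans (cauchy_schwarz _ _))//.
  by rewrite mulrA [_ * C]mulrC ler_wpM2r.
have Sb : S \in @bounded_operator R H by apply/bounded_operatorP; split=> //; exists C.
by exists (BoundedOp Sb) => x y /=; rewrite TS.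
Qed.

Lemma adjointP T x y : hdot (T x) y = hdot x (adjoint T y).
Proof.
rewrite /adjoint; case: xgetP => [S _ TS|noS]; first exact: TS.
by have [S TS] := adjoint_exists T; have := noS S TS.
Qed.

Lemma adjointPr T x y : hdot (adjoint T x) y = hdot x (T y).
Proof. by rewrite dotC -adjointP -dotC. Qed.

Lemma adjoint_unique T S :
  (forall x y, hdot (T x) y = hdot x (S y)) -> adjoint T = S.
Proof.
by move=> TS; apply: opP => y; apply: dot_inj => x; rewrite -adjointP TS.
Qed.

Lemma adjointK T : adjoint (adjoint T) = T.
Proof. by apply: adjoint_unique => x y; rewrite adjointPr. Qed.

Lemma adjointM S T : adjoint (S * T) = adjoint T * adjoint S.
Proof. by apply: adjoint_unique => x y; rewrite !opME !adjointP. Qed.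

Lemma adjoint1 : adjoint 1 = 1 :> 'B(H).
Proof. exact: adjoint_unique. Qed.

Lemma adjointD S T : adjoint (S + T) = adjoint S + adjoint T.
Proof. by apply: adjoint_unique => x y; rewrite !opD dotDl dotDr !adjointP. Qed.

Lemma adjointZ a T : adjoint (a *: T) = a^*%R *: adjoint T.
Proof.
apply: adjoint_unique => x y.
by rewrite !opZE dotZl dotZr conjCK adjointP.
Qed.

Lemma adjointB S T : adjoint (S - T) = adjoint S - adjoint T.
Proof. by apply: adjoint_unique => x y; rewrite !opBE dotBl dotBr !adjointP. Qed.

Lemma scale_opl a S T : (a *: S) * T = a *: (S * T).
Proof. exact: opP. Qed.

Lemma scale_opr a S T : S * (a *: T) = a *: (S * T).
Proof. by apply: opP => x; rewrite !(opME, opZE) op_scale. Qed.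

Definition contraction T := forall x, `|T x| <= `|x|.

Lemma contractionM S T : contraction S -> contraction T -> contraction (S * T).
Proof. by move=> Sc Tc x; rewrite opME (le_trans (Sc _)). Qed.

(** [|T^+ x|^2 = <x, T (T^+ x)>] is at most [|x| |T^+ x|]. *)
Lemma contraction_adjoint T : contraction T -> contraction (adjoint T).
Proof.
move=> Tc x; have [->|Tx0] := eqVneq (adjoint T x) 0; first by rewrite normr0.
rewrite -(@ler_pM2l _ `|adjoint T x|) ?normr_gt0// -expr2 -hdot_norm adjointPr.
have Tx : 0 <= hdot x (T (adjoint T x)).
  by rewrite -adjointPr hdot_norm exprn_ge0.
rewrite -(ger0_norm Tx) (le_trans (cauchy_schwarz _ _))// mulrC ler_wpM2r//.
Qed.

Definition strong_cvg (T : nat -> 'B(H)) S :=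
  forall x, T k x @[k --> \oo] --> S x.

Lemma strong_cvg_const S : strong_cvg (fun=> S) S.
Proof. by move=> x; exact: cvg_cst. Qed.

Lemma strong_cvgD u v S T : strong_cvg u S -> strong_cvg v T ->
  strong_cvg (fun k => u k + v k) (S + T).
Proof. by move=> uS vT x; exact: cvgD (uS x) (vT x). Qed.

Lemma strong_cvgB u v S T : strong_cvg u S -> strong_cvg v T ->
  strong_cvg (fun k => u k - v k) (S - T).
Proof. by move=> uS vT x; exact: cvgB (uS x) (vT x). Qed.

Lemma strong_cvgZ a u S : strong_cvg u S ->
  strong_cvg (fun k => a *: u k) (a *: S).
Proof. by move=> uS x; exact: cvgZl_tmp (uS x). Qed.

Lemma strong_cvgMr u S T : strong_cvg u S ->
  strong_cvg (fun k => u k * T) (S * T).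
Proof. by move=> uS x; exact: uS. Qed.

Lemma strong_cvgMl u S T : strong_cvg u S ->
  strong_cvg (fun k => T * u k) (T * S).
Proof.
have [_ [C C0 TC]] := ge0_bounded_operatorP (op_bounded T).
move=> uS x; apply/cvgrPdist_lt => e e0.
have C1 : 0 < C + 1 by rewrite ltr_wpDl.
have /cvgrPdist_lt/(_ _ (divr_gt0 e0 C1)) := uS x.
apply: filterS => k uk; rewrite !opME -op_sub (le_lt_trans (TC _))//.
rewrite (@le_lt_trans _ _ ((C + 1) * `|S x - u k x|))//.
  by rewrite ler_wpM2r// lerDl.
by rewrite mulrC -ltr_pdivlMr.
Qed.

(** Multiplication is jointly continuous for the strong topology only along
    bounded left factors. *)
Lemma strong_cvgM u v S T : (forall k, contraction (u k)) ->
  strong_cvg u S -> strong_cvg v T ->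
  strong_cvg (fun k => u k * v k) (S * T).
Proof.
move=> uc uS vT x; apply/cvgrPdist_lt => e e0.
have e2 : 0 < e / 2%:R by rewrite divr_gt0.
have /cvgrPdist_lt/(_ _ e2) := vT x; have /cvgrPdist_lt/(_ _ e2) := uS (T x).
apply: filterS2 => k uk vk; rewrite !opME.
have -> : S (T x) - u k (v k x) = (S (T x) - u k (T x)) + u k (T x - v k x).
  by rewrite op_sub addrA subrK.
rewrite (le_lt_trans (ler_normD _ _))// (splitr e) ltrD//.
exact: le_lt_trans (uc _ _) vk.
Qed.

Lemma strong_cvg_unique u S T : strong_cvg u S -> strong_cvg u T -> S = T.
Proof. by move=> uS uT; apply: opP => x; exact: norm_cvg_unique (uS x) (uT x). Qed.

Lemma strong_cvg_shift u S : strong_cvg u S -> strong_cvg (fun k => u k.+1) S.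
Proof. by move=> uS x; have := uS x; rewrite -(cvg_shiftS (fun k => u k x)). Qed.

(** Taking adjoints is not strongly continuous, so the convergence of the
    adjoints is an assumption; their limit is then the adjoint of the limit. *)
Lemma strong_cvg_adjoint u S T : strong_cvg u S ->
  strong_cvg (fun k => adjoint (u k)) T -> adjoint S = T.
Proof.
move=> uS uT; apply: adjoint_unique => x y.
have uT' : (hdot (u k x) y : R[i]^o) @[k --> \oo] --> (hdot x (T y) : R[i]^o).
  have -> : (fun k => hdot (u k x) y) = (fun k => hdot x (adjoint (u k) y)).
    by apply/funext => k; rewrite adjointP.
  exact: cvg_dotr.
exact: norm_cvg_unique (cvg_dotl (uS x)) uT'.
Qed.

Lemma strong_limit_exists u : (forall k, contraction (u k)) ->
  (forall x e, 0 < e -> exists N, forall k l, (N <= k)%N -> (k <= l)%N ->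
    `|u l x - u k x| < e) ->
  exists2 S, strong_cvg u S & contraction S.
Proof.
move=> uc uC; have /choice[S uS] x := cauchy_seq_cvg (uC x).
have S_lin : linear S.
  move=> a x y; have uS' : u k (a *: x + y) @[k --> \oo] --> a *: S x + S y.
    have -> : (fun k => u k (a *: x + y)) = (fun k => a *: u k x + u k y).
      by apply/funext => k; rewrite op_linear.
    exact: cvgD (cvgZl_tmp (uS x)) (uS y).
  exact: norm_cvg_unique (uS _) uS'.
have S_bnd x : `|S x| <= `|x|.
  apply: (cvg_le (fun k => uc k x)); last exact: cvg_cst.
  exact: (@cvg_norm _ H).
have Sb : S \in @bounded_operator R H.
  by apply/bounded_operatorP; split=> //; exists 1 => x; rewrite mul1r.
by exists (BoundedOp Sb).
Qed.

(** Strong convergence implies weak-operator convergence. *)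
Lemma wot_closed_strong (A : set 'B(H)) u S : closed (A : set (wot H)) ->
  (forall k, A (u k)) -> strong_cvg u S -> A S.
Proof.
move=> Acl Au uS.
pose f (T : 'B(H)) : {ptws H * H -> R[i]^o} := fun xy => hdot (T xy.1) xy.2.
have fu : f (u k) @[k --> \oo] --> f S.
  by apply/pointwise_cvgP => -[x y]; exact: cvg_dotl (uS x).
apply: (@closed_cvg _ (wot H) \oo _ (u : nat -> wot H) A Acl _ S).
  by exists 0%N.
move=> U [? /= [[W oW <-]]] /= WS /filterS; apply; apply: fu.
exact: open_nbhs_nbhs.
Qed.

End operators.

(** * Square roots and unitaries in an algebra of operators *)

Section strong_star_algebras.
Variables (R : realType) (H : hilbertType R).
Implicit Types (x y : H) (a : R[i]) (S T X c : 'B(H)) (u : nat -> 'B(H)).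
Implicit Types (A : set 'B(H)).

Lemma conjC_half : (2%:R^-1 : R[i])^*%R = 2%:R^-1.
Proof. by rewrite conj_Creal// realV realn. Qed.

Lemma halves : 2%:R^-1 + 2%:R^-1 = 1 :> R[i].
Proof. by field. Qed.

(** The part of the definition of a von Neumann algebra on which the argument
    relies.  Sequential closedness is weaker than weak-operator closedness, and
    is immediate for the auxiliary commutative algebras below. *)
Record strong_star_algebra A : Prop := StrongStarAlgebra {
  ssa1 : A 1;
  ssaP : forall a S T, A S -> A T -> A (a *: S + T);
  ssaM : forall S T, A S -> A T -> A (S * T);
  ssa_adjoint : forall T, A T -> A (adjoint T);
  ssa_lim : forall u S, (forall k, A (u k)) -> strong_cvg u S -> A S }.

Lemma vN_strong_star_algebra A : is_vN_algebra A -> strong_star_algebra A.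
Proof.
by case=> A1 AP AM Aadj Acl; split=> // u S; exact: wot_closed_strong.
Qed.

Section closure_properties.
Variables (A : set 'B(H)) (A_ssa : strong_star_algebra A).

Lemma ssaD S T : A S -> A T -> A (S + T).
Proof. by move=> AS AT; rewrite -[S]scale1r; apply: ssaP. Qed.

Lemma ssa0 : A 0.
Proof.
by rewrite -[0](subrr 1) addrC -scaleN1r; apply: ssaP => //; exact: ssa1.
Qed.

Lemma ssaZ a T : A T -> A (a *: T).
Proof. by move=> AT; rewrite -[_ *: _]addr0; apply: ssaP => //; exact: ssa0. Qed.

Lemma ssaB S T : A S -> A T -> A (S - T).
Proof. by move=> AS AT; rewrite -scaleN1r; apply: ssaD => //; exact: ssaZ. Qed.

End closure_properties.

(** Commutative algebras are what makes algebra with polynomials in [c], and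
    with limits of such polynomials, available.  The one used here is the
    intersection of [A] with the bicommutant of [c]; the bicommutant is closed
    under adjoints because [c] is selfadjoint. *)
Lemma commutative_star_algebra A c : strong_star_algebra A -> A c ->
  adjoint c = c -> exists A', [/\ strong_star_algebra A', A' `<=` A, A' c &
    forall S T, A' S -> A' T -> S * T = T * S].
Proof.
move=> A_ssa Ac c_sa.
exists [set T | A T /\ forall S, S * c = c * S -> S * T = T * S]; split.
- split.
  + by split; [exact: ssa1|move=> S _; rewrite mulr1 mul1r].
  + move=> a S T [AS ScS] [AT ScT]; split; first exact: ssaP.
    move=> V Vc; rewrite mulrDr mulrDl scale_opr scale_opl.
    by rewrite ScS// ScT.
  + move=> S T [AS ScS] [AT ScT]; split; first exact: ssaM.
    by move=> V Vc; rewrite mulrA ScS// -mulrA ScT// mulrA.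
  + move=> T [AT ScT]; split; first exact: ssa_adjoint.
    move=> V Vc; have := ScT (adjoint V).
    have -> : adjoint V * c = c * adjoint V.
      by have := congr1 (@adjoint R H) Vc; rewrite !adjointM c_sa.
    move=> /(_ erefl) /(congr1 (@adjoint R H)).
    by rewrite !adjointM adjointK.
  + move=> u S Au uS; split.
      by apply: (ssa_lim A_ssa) uS => k; have [] := Au k.
    move=> V Vc; have := strong_cvgMl (T := V) uS.
    have -> : (fun k => V * u k) = (fun k => u k * V).
      by apply/funext => k; have [_ ->] := Au k.
    by move=> /strong_cvg_unique; apply; apply: strong_cvgMr.
- by move=> T [].
- by split=> // S ->.
- by move=> S T [AS ScS] [AT ScT]; apply: ScT; rewrite ScS.
Qed.

Section square_root.
Variable T : 'B(H).
Hypothesis T_contr : contraction T.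

(** A solution [Y] of [Y = (T + Y^2) / 2] satisfies [(1 - Y)^2 = 1 - T]. *)
Fixpoint sqrt_iter k : 'B(H) :=
  if k is k'.+1 then 2%:R^-1 *: (T + sqrt_iter k' * sqrt_iter k') else 0.

(** The same recurrence for the scalar [1] instead of [T].  As its coefficients
    are nonnegative, this increasing sequence dominates the norms of the
    iterates and of their increments. *)
Fixpoint sqrt_bound k : R[i] :=
  if k is k'.+1 then 2%:R^-1 * (1 + sqrt_bound k' ^+ 2) else 0.

Lemma sqrt_iterS k :
  sqrt_iter k.+1 = 2%:R^-1 *: (T + sqrt_iter k * sqrt_iter k).
Proof. by []. Qed.

Lemma sqrt_bound_itv k : 0 <= sqrt_bound k <= 1.
Proof.
elim: k => [|k /andP[s0 s1]]; first by rewrite lexx ler01.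
rewrite /= mulr_ge0 ?addr_ge0 ?exprn_ge0//= ler_pdivrMl// mulr1.
by rewrite [leRHS]mulr2n lerD2l exprn_ile1.
Qed.

Lemma sqrt_bound_nd k l : (k <= l)%N -> sqrt_bound k <= sqrt_bound l.
Proof.
apply: (homo_leq (r := <=%R)) => // [? ? ?|j]; first exact: le_trans.
have /andP[s0 s1] := sqrt_bound_itv j.
rewrite -subr_ge0 /=.
have -> : 2%:R^-1 * (1 + sqrt_bound j ^+ 2) - sqrt_bound j =
    2%:R^-1 * (1 - sqrt_bound j) ^+ 2 by field.
by rewrite mulr_ge0// exprn_ge0// subr_ge0.
Qed.

Lemma sqrt_iter_norm k x : `|sqrt_iter k x| <= sqrt_bound k * `|x|.
Proof.
elim: k x => [|k IHk] x; first by rewrite mul0r normr0.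
have /andP[s0 s1] := sqrt_bound_itv k.
rewrite sqrt_iterS opZE normrZ ger0_norm// -mulrA ler_wpM2l// opD.
rewrite (le_trans (ler_normD _ _))// mulrDl mul1r lerD//.
by rewrite (le_trans (IHk _))// expr2 -mulrA ler_wpM2l.
Qed.

Lemma sqrt_iter_step k x : `|sqrt_iter k.+1 x - sqrt_iter k x| <=
  (sqrt_bound k.+1 - sqrt_bound k) * `|x|.
Proof.
elim: k x => [|k IHk] x.
  rewrite !subr0 (le_trans (sqrt_iter_norm 1 x))//.
set y := sqrt_iter k.+1 in IHk *; set z := sqrt_iter k in IHk *.
set s := sqrt_bound k.+1 in IHk *; set t := sqrt_bound k in IHk *.
have -> : sqrt_iter k.+2 x - y x =
    2%:R^-1 *: (y (y x - z x) + (y (z x) - z (z x))).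
  rewrite op_sub addrA subrK {2}/y !sqrt_iterS -/y -/z !opZE !opD !opME -scalerBr.
  by congr (_ *: _); rewrite opprD addrACA subrr add0r.
have -> : sqrt_bound k.+2 - s = 2%:R^-1 * (s * (s - t) + (s - t) * t).
  have sE : s = 2%:R^-1 * (1 + t ^+ 2) by [].
  by rewrite -[sqrt_bound k.+2]/(2%:R^-1 * (1 + s ^+ 2)) {2}sE; field.
have /andP[s0 s1] := sqrt_bound_itv k.+1; have /andP[t0 t1] := sqrt_bound_itv k.
rewrite normrZ ger0_norm// -mulrA ler_wpM2l// (le_trans (ler_normD _ _))// mulrDl.
have st : 0 <= s - t by rewrite subr_ge0 sqrt_bound_nd.
rewrite lerD//.
  by rewrite (le_trans (sqrt_iter_norm _ _))// -mulrA ler_wpM2l.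
rewrite (le_trans (IHk _))// -mulrA ler_wpM2l//.
exact: sqrt_iter_norm.
Qed.

Lemma sqrt_iter_dist k l x : (k <= l)%N ->
  `|sqrt_iter l x - sqrt_iter k x| <= (sqrt_bound l - sqrt_bound k) * `|x|.
Proof.
elim: l => [|l IHl].
  by rewrite leqn0 => /eqP ->; rewrite !subrr mul0r normr0.
rewrite leq_eqVlt => /predU1P[->|/IHl kl]; first by rewrite !subrr mul0r normr0.
rewrite -(subrKA (sqrt_iter l x)) (le_trans (ler_normD _ _))//.
rewrite -[X in _ <= X * _](subrKA (sqrt_bound l)) mulrDl lerD//.
exact: sqrt_iter_step.
Qed.

(** The iterates are Cauchy uniformly on bounded sets because the dominating
    real sequence is increasing and bounded by [1].  The limit stays in any
    algebra containing [T], which for a commutative algebra says that the square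
    root commutes with everything that [T] is multiplied with there. *)
Lemma sqrt_contraction A : strong_star_algebra A -> A T -> adjoint T = T ->
  exists S, [/\ A S, adjoint S = S & S * S = 1 - T].
Proof.
move=> A_ssa AT T_sa.
have y_contr k : contraction (sqrt_iter k).
  move=> x; rewrite (le_trans (sqrt_iter_norm _ _))//.
  by rewrite ler_piMl//; have /andP[] := sqrt_bound_itv k.
have [|Y yY Y_contr] := @strong_limit_exists _ _ sqrt_iter y_contr.
  move=> x e e0; have x1 : 0 < `|x| + 1 by rewrite ltr_wpDl.
  have [k|k|N NP] := @nondecreasing_bounded_cauchy R sqrt_bound 1 _
      sqrt_bound_nd _ _ (divr_gt0 e0 x1).
  - by have /andP[] := sqrt_bound_itv k.
  - by have /andP[] := sqrt_bound_itv k.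
  exists N => k l Nk kl; rewrite (le_lt_trans (sqrt_iter_dist _ kl))//.
  rewrite (@le_lt_trans _ _ ((sqrt_bound l - sqrt_bound k) * (`|x| + 1)))//.
    by rewrite ler_wpM2l ?lerDl// subr_ge0 sqrt_bound_nd.
  by rewrite -ltr_pdivlMr// NP.
have Ay k : A (sqrt_iter k).
  elim: k => [|k Ak]; first exact: (ssa0 A_ssa).
  exact: (ssaZ A_ssa) (ssaD A_ssa AT (ssaM A_ssa Ak Ak)).
have y_sa k : adjoint (sqrt_iter k) = sqrt_iter k.
  elim: k => [|k IHk]; first by rewrite /= -[0](subrr 1) adjointB !subrr.
  by rewrite sqrt_iterS adjointZ adjointD adjointM IHk T_sa conjC_half.
have AY : A Y by apply: (ssa_lim A_ssa) yY.
have Y_sa : adjoint Y = Y.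
  apply: (strong_cvg_adjoint yY).
  by have -> : (fun k => adjoint (sqrt_iter k)) = sqrt_iter by apply/funext.
have YE : Y = 2%:R^-1 *: (T + Y * Y).
  apply: (strong_cvg_unique (strong_cvg_shift yY)).
  apply: strong_cvgZ; apply: strong_cvgD; first exact: strong_cvg_const.
  exact: strong_cvgM.
have Y2 : Y + Y = T + Y * Y.
  by rewrite {1 2}YE -scalerDl halves scale1r.
exists (1 - Y); split.
- exact: (ssaB A_ssa) (ssa1 A_ssa) AY.
- by rewrite adjointB adjoint1 Y_sa.
- have -> : T = Y + (Y - Y * Y) by rewrite addrA Y2 addrK.
  by rewrite mulrBl mul1r mulrBr mulr1 [in RHS]opprD addrA.
Qed.

End square_root.

(** The unitary is [c + i s] with [s^2 = 1 - c^2]; working in a commutative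
    algebra ensures that [s] commutes with [c]. *)
Lemma half_sum_unitaries A c : strong_star_algebra A -> A c -> adjoint c = c ->
  contraction c -> exists v, [/\ A v, adjoint v * v = 1, v * adjoint v = 1 &
    c = 2%:R^-1 *: (v + adjoint v)].
Proof.
move=> A_ssa Ac c_sa c_contr.
have [A' [A'_ssa A'A A'c A'comm]] := commutative_star_algebra A_ssa Ac c_sa.
have [||s [A's s_sa s2]] :=
  @sqrt_contraction _ (contractionM c_contr c_contr) _ A'_ssa.
- exact: (ssaM A'_ssa).
- by rewrite adjointM c_sa.
have cs : c * s = s * c by exact: A'comm.
have u_adj : adjoint (c + 'i *: s) = c - 'i *: s.
  by rewrite adjointD adjointZ conjCi scaleNr c_sa s_sa.
have s2' : ('i *: s) * ('i *: s) = - (1 - c * c) :> 'B(H).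
  by rewrite scale_opl scale_opr scalerA -expr2 sqrCi scaleN1r s2.
have cs' : c * ('i *: s) = ('i *: s) * c by rewrite scale_opl scale_opr cs.
exists (c + 'i *: s); rewrite u_adj; split.
- exact: A'A (ssaD A'_ssa A'c (ssaZ A'_ssa _ A's)).
- rewrite mulrBl !mulrDr s2' cs' opprD addrA addrK opprK.
  by rewrite addrC subrK.
- rewrite mulrDl !mulrBr s2' cs' opprK addrA subrK.
  by rewrite addrC subrK.
- by rewrite addrACA subrr addr0 scalerDr -scalerDl halves scale1r.
Qed.

End strong_star_algebras.

(** * Polar decomposition by the Newton-Schulz iteration *)

Section newton_schulz.
Variables (R : realType) (H : hilbertType R).
Implicit Types (x y : H) (S T X V n : 'B(H)).

(** This is [X (3 - X^+ X) / 2], written so as to display the increment. *)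
Definition newton_schulz X := X + 2%:R^-1 *: (X * (1 - adjoint X * X)).

Definition ns_iter X k := iter k newton_schulz X.

Lemma ns_iterS X k : ns_iter X k.+1 = newton_schulz (ns_iter X k).
Proof. by []. Qed.

(** By [(1 - X^+ X) X^+ = X^+ (1 - X X^+)] the iteration commutes with adjoints;
    this is what gives the strong convergence of the adjoints of the iterates. *)
Lemma adjoint_newton_schulz X :
  adjoint (newton_schulz X) = newton_schulz (adjoint X).
Proof.
rewrite /newton_schulz adjointD adjointZ conjC_half adjointM adjointB adjoint1.
by rewrite adjointM adjointK mulrBr mulrBl mulr1 mul1r mulrA.
Qed.

Lemma adjoint_ns_iter X k : adjoint (ns_iter X k) = ns_iter (adjoint X) k.
Proof.
by elim: k => [//|k IHk]; rewrite !ns_iterS adjoint_newton_schulz IHk.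
Qed.

Lemma adjoint_ns_iter_seq X :
  (fun k => adjoint (ns_iter X k)) = ns_iter (adjoint X).
Proof. by apply/funext => k; rewrite adjoint_ns_iter. Qed.

(** With [w = (1 - X^+ X) x], the squared norm of the image of [x] is
    [|x|^2 - |w|^2 + |X w|^2 / 4]. *)
Lemma contraction_newton_schulz X :
  contraction X -> contraction (newton_schulz X).
Proof.
move=> Xc x; rewrite -(@ler_pXn2r _ 2)// ?nnegrE//.
pose w := x - adjoint X (X x).
have wE : X w = X ((1 - adjoint X * X) x) by [].
have aE : adjoint X (X x) = x - w by rewrite /w opprB addrC subrK.
have -> : newton_schulz X x = X x + 2%:R^-1 *: X w.
  by rewrite /newton_schulz opD opZE opME wE.
have wx : hdot w x = hdot x w.
  by rewrite /w dotBl dotBr adjointPr -adjointP.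
clearbody w.
have -> : `|X x + 2%:R^-1 *: X w| ^+ 2 =
    `|x| ^+ 2 - (`|w| ^+ 2 - 4%:R^-1 * `|X w| ^+ 2).
  rewrite -!hdot_norm dotDl !dotDr !dotZl !dotZr conjC_half.
  have -> : hdot (X x) (X x) = hdot (x - w) x by rewrite -aE adjointPr.
  have -> : hdot (X x) (X w) = hdot (x - w) w by rewrite -aE adjointPr.
  have -> : hdot (X w) (X x) = hdot w (x - w) by rewrite -aE adjointP.
  by rewrite !dotBl dotBr wx; field.
rewrite lerBlDr lerDl subr_ge0 ler_pdivrMl// (@le_trans _ _ (`|w| ^+ 2))//.
  by rewrite ler_pXn2r ?nnegrE.
by rewrite ler_peMl ?exprn_ge0// ler1n.
Qed.

Lemma contraction_ns_iter X k : contraction X -> contraction (ns_iter X k).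
Proof.
by move=> Xc; elim: k => [//|k IHk]; exact: contraction_newton_schulz.
Qed.

(** In a commutative algebra containing [X^+ X], all the products [X_k^+ X_l] of
    iterates commute, being polynomials in [X^+ X]. *)
Section monotone.
Variables (X : 'B(H)) (A : set 'B(H)).
Hypotheses (X_contr : contraction X) (A_ssa : strong_star_algebra A).
Hypotheses (A_comm : forall S T, A S -> A T -> S * T = T * S).
Hypothesis A_X : A (adjoint X * X).

Lemma ns_iter_factor k :
  exists p, [/\ A p, adjoint p = p & ns_iter X k = X * p].
Proof.
elim: k => [|k [p [Ap p_sa XE]]].
  by exists 1; rewrite adjoint1 mulr1; split=> //; exact: ssa1.
pose q := 1 - p * (adjoint X * X) * p.
have Aq : A q.
  apply: (ssaB A_ssa); [exact: ssa1|do 2! apply: (ssaM A_ssa) => //].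
have q_sa : adjoint q = q.
  by rewrite /q adjointB adjoint1 !adjointM adjointK p_sa !mulrA.
exists (p + 2%:R^-1 *: (p * q)); split.
- exact: (ssaD A_ssa) Ap (ssaZ A_ssa _ (ssaM A_ssa Ap Aq)).
- by rewrite adjointD adjointZ conjC_half adjointM p_sa q_sa A_comm.
- rewrite ns_iterS XE /newton_schulz adjointM p_sa [RHS]mulrDr scale_opr /q.
  by rewrite !mulrA.
Qed.

Lemma gram_mem k l : A (adjoint (ns_iter X k) * ns_iter X l) /\
  adjoint (adjoint (ns_iter X k) * ns_iter X l) =
    adjoint (ns_iter X k) * ns_iter X l.
Proof.
have [p [Ap p_sa ->]] := ns_iter_factor k.
have [q [Aq q_sa ->]] := ns_iter_factor l.
rewrite !adjointM !adjointK p_sa q_sa.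
have -> : p * adjoint X * (X * q) = p * (adjoint X * X) * q by rewrite !mulrA.
have -> : q * adjoint X * (X * p) = q * (adjoint X * X) * p by rewrite !mulrA.
split; first by do 2! apply: (ssaM A_ssa) => //.
rewrite (A_comm (ssaM A_ssa Aq A_X) Ap) (A_comm Aq A_X) mulrA //.
Qed.

(** In operator terms, [X_k^+ X_k <= X_k^+ X_l].  The increment in [l] is half of
    [X_k^+ X_l (1 - X_l^+ X_l)]; if [r] is a square root of the last factor, it
    equals [r X_k^+ X_l r], which is positive by induction. *)
Lemma gram_ge k l x : (k <= l)%N ->
  `|ns_iter X k x| ^+ 2 <= hdot (ns_iter X l x) (ns_iter X k x).
Proof.
elim: l x => [|l IHl] x; first by rewrite leqn0 => /eqP ->; rewrite hdot_norm.
rewrite leq_eqVlt => /predU1P[->|kl]; first by rewrite hdot_norm.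
have [Akl _] := gram_mem k l; have [All ll_sa] := gram_mem l l.
have ll_contr : contraction (adjoint (ns_iter X l) * ns_iter X l).
  have Xl := contraction_ns_iter l X_contr.
  exact: contractionM (contraction_adjoint Xl) Xl.
have [r [Ar r_sa r2]] := sqrt_contraction ll_contr A_ssa All ll_sa.
rewrite ns_iterS /newton_schulz -r2 opD dotDl -[leLHS]addr0 lerD ?IHl//.
rewrite opZE dotZl mulr_ge0//.
rewrite -adjointPr -opME mulrA mulrA (A_comm Akl Ar).
rewrite opME opME -{1}r_sa adjointPr opME adjointPr.
by rewrite (le_trans _ (IHl _ kl))// exprn_ge0.
Qed.

(** Expanding the square leaves the cross term [- 2 <X_l x, X_k x>], which
    [gram_ge] bounds by [- 2 |X_k x|^2]. *)
Lemma ns_iter_dist k l x : (k <= l)%N ->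
  `|ns_iter X l x - ns_iter X k x| ^+ 2 <=
    `|ns_iter X l x| ^+ 2 - `|ns_iter X k x| ^+ 2.
Proof.
move=> kl; have kl_ge := gram_ge x kl.
rewrite -[leLHS]hdot_norm dotBl !dotBr !hdot_norm.
rewrite [hdot (ns_iter X k x) _]dotC conj_Creal; last first.
  by rewrite ger0_real// (le_trans _ kl_ge)// exprn_ge0.
set d := hdot _ _ in kl_ge *; set a := _ ^+ 2 in kl_ge *; set b := _ ^+ 2.
rewrite -subr_ge0 (_ : _ - _ = 2%:R * (d - a)); last by ring.
by rewrite mulr_ge0// subr_ge0.
Qed.

Lemma ns_iter_norm_nd k l x : (k <= l)%N ->
  `|ns_iter X k x| ^+ 2 <= `|ns_iter X l x| ^+ 2.
Proof.
move=> /(ns_iter_dist x) le_kl.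
by rewrite -subr_ge0 (le_trans _ le_kl)// exprn_ge0.
Qed.

Lemma ns_iter_cauchy x e : 0 < e -> exists N, forall k l,
  (N <= k)%N -> (k <= l)%N -> `|ns_iter X l x - ns_iter X k x| < e.
Proof.
move=> e0.
have [k|k l|k|N NP] := @nondecreasing_bounded_cauchy R
    (fun k => `|ns_iter X k x| ^+ 2) (`|x| ^+ 2) _ _ _ _ (exprn_gt0 2 e0).
- by rewrite exprn_ge0.
- exact: ns_iter_norm_nd.
- by rewrite ler_pXn2r ?nnegrE//; exact: contraction_ns_iter.
exists N => k l Nk kl; rewrite -(@ltr_pXn2r _ 2)// ?nnegrE// ?(ltW e0)//.
exact: le_lt_trans (ns_iter_dist x kl) (NP k l Nk kl).
Qed.

End monotone.

Lemma gram_algebra X : exists A, [/\ strong_star_algebra A,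
  forall S T, A S -> A T -> S * T = T * S & A (adjoint X * X)].
Proof.
have T_ssa : strong_star_algebra [set: 'B(H)] by [].
have X_sa : adjoint (adjoint X * X) = adjoint X * X.
  by rewrite adjointM adjointK.
have [A [? ? ? ?]] :=
  commutative_star_algebra T_ssa (c := adjoint X * X) I X_sa.
by exists A.
Qed.

Lemma ns_iter_limit X : contraction X -> exists V,
  [/\ strong_cvg (ns_iter X) V, contraction V & forall x, `|X x| <= `|V x|].
Proof.
move=> Xc; have [A [A_ssa A_comm AX]] := gram_algebra X.
have [|V XV Vc] := @strong_limit_exists _ _ (ns_iter X)
  (fun k => contraction_ns_iter k Xc).
  exact: ns_iter_cauchy A_ssa A_comm AX.
exists V; split=> // x.
have XVx : `|ns_iter X k x| @[k --> \oo] --> `|V x|.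
  exact: (@cvg_norm _ H).
have le_k k : `|X x| <= `|ns_iter X k x|.
  rewrite -(@ler_pXn2r _ 2)// ?nnegrE//.
  exact: (ns_iter_norm_nd Xc A_ssa A_comm AX x (leq0n k)).
by apply: (cvg_le le_k) XVx; exact: cvg_cst.
Qed.

(** [V V^+ n = n] because [|n^+ y| <= |V^+ y|] for all [y], by monotonicity of the
    iteration started at [n^+]: since [V^+ (1 - V V^+) = 0], also
    [n^+ (1 - V V^+) = 0].  And [V^+ n] is selfadjoint as the limit of the
    products [X_k^+ X_0]. *)
Lemma polar_decomposition n : contraction n -> exists V,
  [/\ strong_cvg (ns_iter n) V,
      strong_cvg (fun k => adjoint (ns_iter n k)) (adjoint V),
      contraction V, V * adjoint V * V = V &
      n = V * (adjoint V * n) /\ adjoint (adjoint V * n) = adjoint V * n].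
Proof.
move=> nc; have [V [nV Vc _]] := ns_iter_limit nc.
have [W [nW Wc nW_le]] := ns_iter_limit (contraction_adjoint nc).
have VW : adjoint V = W.
  apply: strong_cvg_adjoint nV _.
  by rewrite adjoint_ns_iter_seq.
rewrite -{W}VW -adjoint_ns_iter_seq in nW Wc nW_le.
have pV : V * adjoint V * V = V.
  have : V + 2%:R^-1 *: (V * (1 - adjoint V * V)) = V.
    apply: strong_cvg_unique (strong_cvg_shift nV).
    apply: strong_cvgD => //; apply: strong_cvgZ.
    apply: strong_cvgM => [k||]; [exact: contraction_ns_iter|exact: nV|].
    apply: strong_cvgB; first exact: strong_cvg_const.
    apply: strong_cvgM => // k.
    exact: contraction_adjoint (contraction_ns_iter k nc).
  rewrite -[RHS]addr0 => /addrI /(congr1 (fun T => 2%:R *: T)).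
  rewrite scaler0 scalerA divff// scale1r mulrBr mulr1 mulrA.
  by move=> /subr0_eq.
have nQ : adjoint n * (1 - V * adjoint V) = 0.
  apply: opP => y; rewrite opME.
  apply/eqP; rewrite -normr_le0 (le_trans (nW_le _))// -opME.
  have -> : adjoint V * (1 - V * adjoint V) = 0.
    have := congr1 (@adjoint R H) pV; rewrite !adjointM adjointK => pV'.
    by rewrite mulrBr mulr1 pV' subrr.
  by rewrite normr0.
exists V; split=> //; split.
  move: nQ; rewrite mulrBr mulr1 => /subr0_eq /(congr1 (@adjoint _ H)).
  by rewrite !adjointM !adjointK mulrA.
have [A [A_ssa A_comm An]] := gram_algebra n.
have nVn : strong_cvg (fun k => adjoint (ns_iter n k) * n) (adjoint V * n).
  exact: strong_cvgMr.
apply: (strong_cvg_adjoint nVn).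
have -> // : (fun k => adjoint (adjoint (ns_iter n k) * n)) =
  (fun k => adjoint (ns_iter n k) * n).
by apply/funext => k; have [_] := gram_mem A_ssa A_comm An k 0.
Qed.

End newton_schulz.

(** * Linear spans *)

Section span.
Variables (R : realType) (H : hilbertType R).
Implicit Types (X P : set 'B(H)) (S T : 'B(H)).

Lemma cspanP X a S T : cspan X S -> cspan X T -> cspan X (a *: S + T).
Proof.
move=> [k [c [s [Xs ->]]]] [l [d [t [Xt ->]]]].
exists (k + l)%N,
  (fun i : 'I_(k + l) =>
     match fintype.split i with inl j => a * c j | inr j => d j end),
  (fun i : 'I_(k + l) =>
     match fintype.split i with inl j => s j | inr j => t j end).
split=> [i|]; first by case: (fintype.split i).
rewrite big_split_ord scaler_sumr /=; congr (_ + _); apply: eq_bigr => i _.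
  by rewrite (unsplitK (inl i)) scalerA.
by rewrite (unsplitK (inr i)).
Qed.

Lemma sub_cspan X : X `<=` cspan X.
Proof.
move=> T XT; exists 1%N, (fun=> 1), (fun=> T); split=> //.
by rewrite big_ord1 scale1r.
Qed.

Lemma cspan_min X P : P 0 -> (forall a S T, P S -> P T -> P (a *: S + T)) ->
  X `<=` P -> cspan X `<=` P.
Proof.
move=> P0 PP XP _ [k [c [s [Xs ->]]]].
elim/big_rec: _ => [//|i T _ PT]; exact: PP (XP _ (Xs i)) PT.
Qed.

Lemma cspan0 X : cspan X 0.
Proof.
by exists 0%N, (fun=> 0), (fun=> 0); split=> [[]//|]; rewrite big_ord0.
Qed.

End span.

(** * Normalisers *)

Section normalisers.
Variables (R : realType) (H : hilbertType R) (B M : set 'B(H)).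
Hypothesis BM : unital_inclusion B M.
Implicit Types (n b v : 'B(H)).

Let B_ssa : strong_star_algebra B.
Proof. by case: BM => _ [/vN_strong_star_algebra]. Qed.

Let M_ssa : strong_star_algebra M.
Proof. by case: BM => /vN_strong_star_algebra. Qed.

Let sBM : B `<=` M.
Proof. by case: BM => _ []. Qed.

Lemma normaliser_gram n : normaliser B M n -> B (adjoint n * n).
Proof. by case=> _ /(_ 1 (ssa1 B_ssa)) []; rewrite !mulr1. Qed.

Lemma normaliser_mulr n b : normaliser B M n -> B b -> normaliser B M (n * b).
Proof.
move=> [Mn nB] Bb; split; first exact: ssaM M_ssa _ _ Mn (sBM Bb).
have Bb' := ssa_adjoint B_ssa Bb.
move=> d Bd; rewrite adjointM; split.
  have -> : n * b * d * (adjoint b * adjoint n) =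
      n * (b * d * adjoint b) * adjoint n by rewrite !mulrA.
  by have [] := nB _ (ssaM B_ssa (ssaM B_ssa Bb Bd) Bb').
have -> : adjoint b * adjoint n * d * (n * b) =
    adjoint b * (adjoint n * d * n) * b by rewrite !mulrA.
by have [_ Bn] := nB _ Bd; exact: (ssaM B_ssa (ssaM B_ssa Bb' Bn) Bb).
Qed.

(** The second part is what puts the factor [V^+ n] of [n] in [B]. *)
Lemma normaliser_ns_iter n k : normaliser B M n ->
  normaliser B M (ns_iter n k) /\ B (adjoint (ns_iter n k) * n).
Proof.
move=> Nn; elim: k => [|k [Nk Bk]]; first by split=> //; exact: normaliser_gram.
set X := ns_iter n k in Nk Bk.
pose b := 1 + 2%:R^-1 *: (1 - adjoint X * X).
have Bb : B b.
  apply: (ssaD B_ssa) (ssa1 B_ssa) (ssaZ B_ssa _ _).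
  exact: (ssaB B_ssa) (ssa1 B_ssa) (normaliser_gram Nk).
have XE : ns_iter n k.+1 = X * b.
  by rewrite ns_iterS /newton_schulz -/X [RHS]mulrDr mulr1 scale_opr.
rewrite XE; split; first exact: normaliser_mulr.
rewrite adjointM -mulrA; exact: (ssaM B_ssa) (ssa_adjoint B_ssa Bb) Bk.
Qed.

(** Conjugation by the iterates and by their adjoints passes to the limit only
    because both sequences converge strongly. *)
Lemma normaliser_lim (u : nat -> 'B(H)) v :
  (forall k, normaliser B M (u k)) -> (forall k, contraction (u k)) ->
  strong_cvg u v -> strong_cvg (fun k => adjoint (u k)) (adjoint v) ->
  normaliser B M v.
Proof.
move=> Nu uc uv uv'; split.
  by apply: (ssa_lim M_ssa) uv => k; case: (Nu k).
move=> b Bb; split.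
- apply: (ssa_lim B_ssa) (_ : strong_cvg (fun k => u k * b * adjoint (u k)) _).
    by move=> k; have [_ /(_ _ Bb)[]] := Nu k.
  under [X in strong_cvg X]eq_fun do rewrite -mulrA.
  rewrite -mulrA; apply: strong_cvgM => //; exact: strong_cvgMl.
- apply: (ssa_lim B_ssa) (_ : strong_cvg (fun k => adjoint (u k) * b * u k) _).
    by move=> k; have [_ /(_ _ Bb)[]] := Nu k.
  under [X in strong_cvg X]eq_fun do rewrite -mulrA.
  rewrite -mulrA; apply: strong_cvgM => [k||] //; last exact: strong_cvgMl.
  exact: contraction_adjoint.
Qed.

(** [n = V c = (V w + V w^+) / 2] with [w] a unitary of [B].  For a unitary [w],
    [(V w) (V w)^+ (V w) = V V^+ V w = V w]. *)
Lemma contraction_normaliser_cspan n : normaliser B M n -> contraction n ->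
  cspan (groupoid_normaliser B M) n.
Proof.
move=> Nn nc; have [V [nV nV' Vc pV [nE c_sa]]] := polar_decomposition nc.
have NV : normaliser B M V.
  apply: normaliser_lim nV nV' => k; last exact: contraction_ns_iter.
  by have [] := normaliser_ns_iter k Nn.
have Bc : B (adjoint V * n).
  apply: (ssa_lim B_ssa) (strong_cvgMr nV') => k.
  by have [] := normaliser_ns_iter k Nn.
have cc := contractionM (contraction_adjoint Vc) nc.
have [u [Bu u'u uu' cE]] := half_sum_unitaries B_ssa Bc c_sa cc.
have GN w : B w -> w * adjoint w = 1 -> groupoid_normaliser B M (V * w).
  move=> Bw ww'; split; first exact: normaliser_mulr.
  rewrite adjointM.
  have -> : V * w * (adjoint w * adjoint V) * (V * w) =
     V * (w * adjoint w) * adjoint V * V * w by rewrite !mulrA.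
  by rewrite ww' mulr1 pV.
have Gu : groupoid_normaliser B M (V * u) by exact: GN.
have Gu' : groupoid_normaliser B M (V * adjoint u).
  by apply: GN; rewrite ?adjointK//; exact: ssa_adjoint.
rewrite nE cE scale_opr mulrDr scalerDr.
apply: cspanP; first exact: sub_cspan.
by rewrite -[_ *: _]addr0; apply: cspanP; [exact: sub_cspan|exact: cspan0].
Qed.

Lemma normaliser_cspan n : normaliser B M n ->
  cspan (groupoid_normaliser B M) n.
Proof.
move=> Nn; have [_ [C C0 nC]] := ge0_bounded_operatorP (op_bounded n).
have C1 : 0 < C + 1 by rewrite ltr_wpDl.
have -> : n = (C + 1) *: ((C + 1)^-1 *: n) + 0.
  by rewrite scalerA divff ?gt_eqF// scale1r addr0.
apply: cspanP; last exact: cspan0.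
apply: contraction_normaliser_cspan.
  rewrite -[n]mulr1 -scale_opr; apply: normaliser_mulr => //.
  exact: (ssaZ B_ssa) (ssa1 B_ssa).
move=> x; rewrite opZE normrZ gtr0_norm ?invr_gt0// ler_pdivrMl//.
by rewrite (le_trans (nC _))// ler_wpM2r// lerDl.
Qed.

Lemma cspan_normaliser :
  cspan (normaliser B M) = cspan (groupoid_normaliser B M).
Proof.
apply/seteqP; split; apply: cspan_min;
  [exact: cspan0|exact: cspanP|exact: normaliser_cspan|
   exact: cspan0|exact: cspanP|].
by move=> v [Nv _]; exact: sub_cspan.
Qed.

End normalisers.

Lemma vN_generated_cspan (R : realType) (H : hilbertType R)
    (M X : set 'B(H)) : vN_generated M (cspan X) = vN_generated M X.
Proof.
rewrite /vN_generated; congr (\bigcap_(A in _) _).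
apply/seteqP; split=> A /= [[A_vN AM] XA]; split=> //.
  exact: subset_trans (@sub_cspan _ _ X) XA.
have A_ssa := vN_strong_star_algebra A_vN.
by apply: cspan_min => //; [exact: ssa0|exact: ssaP].
Qed.

Theorem theorem2p6 (R : realType) (H : hilbertType R) (B M : set 'B(H))
    (BM : unital_inclusion B M) :
  cspan (normaliser B M) = cspan (groupoid_normaliser B M) /\
  (regular B M <-> groupoid_regular B M).
Proof.
split; first exact: cspan_normaliser.
rewrite /regular /groupoid_regular -vN_generated_cspan cspan_normaliser//.
by rewrite vN_generated_cspan.
Qed.
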